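(* Let $(\mathfrak g,\mathfrak s,V)$ be a real generic kinematical Lie algebra ($\mathbb K=\mathbb R$), with decomposition $\mathfrak g=\mathcal Z\oplus\mathfrak s\oplus\mathcal P$, whose associated symplectic iLa $(\mathfrak g,\sigma,\Omega)$ is indecomposable and non-flat. Suppose the action of $\mathcal Z$ on $\mathcal P$ to be (possibly complex) semisimple. Then: (i) if the action of $\mathcal Z$ on $\mathcal P$ is not real semisimple, then the symmetric space admits a symplectic-compatible complex structure: the siLa $(\mathfrak g,\sigma,\Omega)$ is pseudo-Hermitian. (ii) If the action of $\mathcal Z$ on $\mathcal P$ is real semisimple, then the symmetric space admits a symplectic-compatible para-complex structure: the siLa $(\mathfrak g,\sigma,\Omega)$ is para-Hermitian.
   Context: An $\mathfrak s$-module $M$ over $\mathbb K$ is absolutely simple if it is simple and the only $\mathbb K$-endomorphisms of $M$ commuting with $\mathfrak s$ are the scalars. For an $\mathfrak s$-module $W$ and an irreducible $\mathfrak s$-module $L$, the weak isotypical component of $L$ in $W$ is the vector sum of all submodules of $W$ isomorphic to $L$; ''empty'' means it is $\{0\}$. A generic kinematical Lie algebra over $\mathbb K$ is a triple $(\mathfrak g,\mathfrak s,V)$ where $\mathfrak g$ is a finite-dimensional Lie algebra over $\mathbb K$; $\mathfrak s$ is a Lie subalgebra of $\mathfrak g$; $V$ is a faithful absolutely simple finite-dimensional $\mathfrak s$-module over $\mathbb K$ such that the weak isotypical component of $V$ in $\Lambda^2(V)$ is empty and the $\mathfrak s$-action preserves a non-degenerate scalar product on $V$ (not necessarily positive definite);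 and $\mathfrak g=\mathcal Z\oplus\mathfrak s\oplus\mathcal P$ as a vector space, with $\mathcal P$ an $\mathfrak s$-stable subspace isomorphic to $V\oplus V$ as $\mathfrak s$-module, and $\mathcal Z$ a line centralizing $\mathfrak s$ in $\mathfrak g$. Put $\mathfrak h:=\mathcal Z\oplus\mathfrak s$. An iLa is a pair $(\mathfrak g,\sigma)$ with $\sigma$ an involutive automorphism of the finite-dimensional Lie algebra $\mathfrak g$, with $\pm1$-eigenspaces $\mathfrak g=\mathfrak h\oplus\mathcal P$. A symplectic iLa (siLa) is a triple $(\mathfrak g,\sigma,\Omega)$ with in addition $\Omega$ an $\mathfrak h$-invariant non-degenerate skew-symmetric bilinear form on $\mathcal P$. The siLa associated with an (indecomposable, non-flat) generic kinematical Lie algebra is given by $\sigma=\mathrm{id}_{\mathcal Z\oplus\mathfrak s}\oplus(-\mathrm{id}_{\mathcal P})$ and $\Omega(X,Y)=[X,Y]+\mathfrak s\in\mathfrak h/\mathfrak s\simeq\mathbb K$. Flat means $[\mathcal P,\mathcal P]$ centralizes $\mathcal P$; decomposable means isomorphic to a direct sum of two non-trivial iLa's (siLa's); indecomposable means not decomposable. A siLa is pseudo-Hermitian (resp. para-Hermitian) if there exists a symplectic endomorphism $J$ of $\mathcal P$ (i.e. $J\in\mathfrak{sp}(\mathcal P,\Omega)$: $\Omega(JX,Y)+\Omega(X,JY)=0$) commuting with $\mathrm{ad}_Z|_{\mathcal P}$ for every $Z\in\mathfrak h$ and such that $J^2=-\mathrm{id}_{\mathcal P}$ (resp. $J^2=\mathrm{id}_{\mathcal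 P}$). The action of $\mathcal Z$ on $\mathcal P$ is semisimple if $\mathrm{ad}_{Z_0}|_{\mathcal P}$ is diagonalizable over $\mathbb C$ for a generator $Z_0$ of $\mathcal Z$, and real semisimple if it is diagonalizable over $\mathbb R$. *)

(* Defs.v *)
From HB Require Import structures.
From mathcomp Require Import all_boot all_order all_algebra.
From mathcomp Require Import reals complex.

Set Implicit Arguments.
Unset Strict Implicit.
Unset Printing Implicit Defensive.

Import GRing.Theory.
Local Open Scope ring_scope.

(** Finite-dimensional Lie algebras *)

HB.mixin Record Vector_isLieAlgebra (F : fieldType) g of Vector F g := {
  lie_bracket : g -> g -> g;
  lie_linear_l : forall y : g, linear (lie_bracket^~ y);
  lie_linear_r : forall x : g, linear (lie_bracket x);
  lie_alt : forall x : g, lie_bracket x x = 0;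
  lie_jacobi : forall x y z : g,
    lie_bracket x (lie_bracket y z) + lie_bracket y (lie_bracket z x)
      + lie_bracket z (lie_bracket x y) = 0
}.

#[short(type="lieAlgType")]
HB.structure Definition LieAlgebra (F : fieldType) :=
  { g of Vector_isLieAlgebra F g & Vector F g }.

Notation "[ 'lie' x , y ]" := (lie_bracket x y)
  (at level 0, x at level 99, y at level 99, format "[ 'lie'  x ,  y ]") : ring_scope.

Record lieSubalgebra (F : fieldType) (g : lieAlgType F) := LieSubalgebra {
  lsub_space :> {vspace g};
  lsub_closed : forall x y : g,
    x \in lsub_space -> y \in lsub_space -> [lie x, y] \in lsub_space
}.

Section SubLieAlgebra.
Variables (F : fieldType) (g : lieAlgType F) (s : lieSubalgebra g).
Let T := subvs_of (lsub_space s).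

Definition sub_bracket (x y : T) : T := vsproj s [lie vsval x, vsval y].

Lemma sub_bracketE (x y : T) : vsval (sub_bracket x y) = [lie vsval x, vsval y].
Proof. by rewrite vsprojK // lsub_closed // subvsP. Qed.

Let sub_linear_l (y : T) : linear (sub_bracket^~ y).
Proof.
move=> a u v; apply: subvs_inj; rewrite sub_bracketE linearP [RHS]linearP /= !sub_bracketE.
exact: (lie_linear_l (vsval y) a).
Qed.

Let sub_linear_r (x : T) : linear (sub_bracket x).
Proof.
move=> a u v; apply: subvs_inj; rewrite sub_bracketE linearP [RHS]linearP /= !sub_bracketE.
exact: (lie_linear_r (vsval x) a).
Qed.

Let sub_alt (x : T) : sub_bracket x x = 0.
Proof. by apply: subvs_inj; rewrite sub_bracketE lie_alt. Qed.

Let sub_jacobi (x y z : T) :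
  sub_bracket x (sub_bracket y z) + sub_bracket y (sub_bracket z x)
    + sub_bracket z (sub_bracket x y) = 0.
Proof. by apply: subvs_inj; rewrite !linearD /= !sub_bracketE lie_jacobi. Qed.

HB.instance Definition _ := Vector_isLieAlgebra.Build F (subvs_of (lsub_space s))
  sub_linear_l sub_linear_r sub_alt sub_jacobi.
End SubLieAlgebra.

Section ProdLieAlgebra.
Variables (F : fieldType) (g1 g2 : lieAlgType F).
Let T := (g1 * g2)%type.

Definition prod_bracket (x y : T) : T := ([lie x.1, y.1], [lie x.2, y.2]).

Let prod_linear_l (y : T) : linear (prod_bracket^~ y).
Proof. by move=> a u v; rewrite /prod_bracket /= !lie_linear_l. Qed.

Let prod_linear_r (x : T) : linear (prod_bracket x).
Proof. by move=> a u v; rewrite /prod_bracket /= !lie_linear_r. Qed.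

Let prod_alt (x : T) : prod_bracket x x = 0.
Proof. by rewrite /prod_bracket !lie_alt. Qed.

Let prod_jacobi (x y z : T) :
  prod_bracket x (prod_bracket y z) + prod_bracket y (prod_bracket z x)
    + prod_bracket z (prod_bracket x y) = 0.
Proof. by congr pair; rewrite /= lie_jacobi. Qed.

HB.instance Definition _ := Vector_isLieAlgebra.Build F (g1 * g2)%type
  prod_linear_l prod_linear_r prod_alt prod_jacobi.
End ProdLieAlgebra.

(** Modules over a Lie algebra *)

Section Modules.
Variables (F : fieldType) (L : lieAlgType F).
Implicit Types V W : vectType F.

Definition lie_module V (rho : L -> 'End(V)) : Prop :=
  linear rho /\
  (forall x y : L, rho [lie x, y] = (rho x \o rho y)%VF - (rho y \o rho x)%VF).

Definition faithful V (rho : L -> 'End(V)) : Prop :=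
  forall x : L, rho x = 0 -> x = 0.

Definition stable V (rho : L -> 'End(V)) (U : {vspace V}) : Prop :=
  forall x : L, (rho x @: U <= U)%VS.

Definition simple_module V (rho : L -> 'End(V)) : Prop :=
  ({:V} != 0)%VS /\
  (forall U : {vspace V}, stable rho U -> U = 0%VS \/ U = {:V}%VS).

Definition absolutely_simple V (rho : L -> 'End(V)) : Prop :=
  simple_module rho /\
  (forall f : 'End(V), (forall x : L, (f \o rho x)%VF = (rho x \o f)%VF) ->
     exists a : F, f = a *: \1%VF).

(* [U] is a submodule of [W] isomorphic to [V]; stability of [U] follows from
   equivariance of the isomorphism. *)
Definition submodule_iso V W (rhoV : L -> 'End(V)) (rhoW : L -> 'End(W))
    (U : {vspace W}) : Prop :=
  exists f : 'Hom(V, W),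
    [/\ lker f = 0%VS, limg f = U & forall x v, f (rhoV x v) = rhoW x (f v)].

Definition in_weak_isotypic V W (rhoV : L -> 'End(V)) (rhoW : L -> 'End(W))
    (W0 : {vspace W}) (w : W) : Prop :=
  exists Us : seq {vspace W},
    (forall U, U \in Us -> (U <= W0)%VS /\ submodule_iso rhoV rhoW U)
    /\ w \in (\sum_(U <- Us) U)%VS.

Definition weak_isotypic_empty V W (rhoV : L -> 'End(V)) (rhoW : L -> 'End(W))
    (W0 : {vspace W}) : Prop :=
  forall w : W, in_weak_isotypic rhoV rhoW W0 w -> w = 0.

Definition prod_rep V W (rhoV : L -> 'End(V)) (rhoW : L -> 'End(W)) (x : L) :
    'End((V * W)%type) :=
  linfun (fun v : V * W => (rhoV x v.1, rhoW x v.2)).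

Definition preserves_scalar_product V (rho : L -> 'End(V)) : Prop :=
  exists b : {symmetric V},
    nondegenerate b /\
    (forall x u v, b (rho x u) v + b u (rho x v) = 0).
End Modules.

(** The exterior square *)

Section ExteriorSquare.
Variables (F : fieldType) (V : vectType F).

Definition dual_space : vectType F := 'Hom(V, F^o).

(* [V (x) V] is realised as [Hom(V^*, V)], where [x (x) y] is the map
   [phi |-> phi x *: y], and [Lambda^2 V] as its subspace spanned by the
   [x (x) y - y (x) x] (over a field of any characteristic this is a copy of
   the quotient of [V (x) V] by the [x (x) x]). *)
Definition tens2 : vectType F := 'Hom(dual_space, V).

Definition wedge (x y : V) : tens2 :=
  linfun (fun phi : dual_space => phi x *: y - phi y *: x).

Definition ext2 : {vspace tens2} :=
  <<[seq wedge x y | x <- vbasis {:V}, y <- vbasis {:V}]>>%VS.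

Lemma wedgeE (x y : V) (phi : dual_space) :
  wedge x y phi = phi x *: y - phi y *: x.
Proof.
have lin : linear (fun phi : dual_space => phi x *: y - phi y *: x).
  move=> a u v; rewrite !add_lfunE !scale_lfunE !scalerDl scalerBr !scalerA.
  by rewrite !opprD !addrA; congr (_ - _); rewrite addrAC.
pose h := GRing.isLinear.Build _ _ _ _ _ lin.
pose f : {linear dual_space -> V} := HB.pack (fun phi : dual_space => phi x *: y - phi y *: x) h.
exact: (lfunE f phi).
Qed.

Definition dual_map (f : 'End(V)) : 'End(dual_space) :=
  linfun (fun phi : dual_space => (phi \o f)%VF : dual_space).

(* The derivation of the tensor square induced by [f]: as a map [V^* -> V],
   [f x (x) y + x (x) f y] is [t \o f^* + f \o t] for [t = x (x) y]. *)
Definition tens2_map (f : 'End(V)) : 'End(tens2) :=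
  linfun (fun t : tens2 => ((f \o t) + (t \o dual_map f))%VF : tens2).

Lemma dual_mapE f (phi : dual_space) : dual_map f phi = (phi \o f)%VF.
Proof.
have lin : linear (fun phi : dual_space => (phi \o f)%VF : dual_space).
  by move=> a u v; apply/lfunP => x; rewrite !(comp_lfunE, add_lfunE, scale_lfunE).
pose h := GRing.isLinear.Build _ _ _ _ _ lin.
pose k : {linear dual_space -> dual_space} :=
  HB.pack (fun phi : dual_space => (phi \o f)%VF : dual_space) h.
exact: (lfunE k phi).
Qed.

Lemma tens2_mapE f (t : tens2) : tens2_map f t = (f \o t)%VF + (t \o dual_map f)%VF.
Proof.
have lin : linear (fun t : tens2 => ((f \o t) + (t \o dual_map f))%VF : tens2).
  move=> a u v; apply/lfunP => x; rewrite !(comp_lfunE, add_lfunE, scale_lfunE).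
  by rewrite linearP scalerDr addrACA.
pose h := GRing.isLinear.Build _ _ _ _ _ lin.
pose k : {linear tens2 -> tens2} :=
  HB.pack (fun t : tens2 => ((f \o t) + (t \o dual_map f))%VF : tens2) h.
exact: (lfunE k t).
Qed.

Lemma tens2_map_wedge f x y :
  tens2_map f (wedge x y) = wedge (f x) y + wedge x (f y).
Proof.
apply/lfunP => phi; rewrite tens2_mapE !add_lfunE !comp_lfunE !wedgeE dual_mapE.
rewrite !comp_lfunE linearB !linearZ /= addrC.
by rewrite addrACA [RHS]addrACA; congr (_ + _); rewrite addrC.
Qed.
End ExteriorSquare.

(** Generic kinematical Lie algebras *)

Section Kinematical.
Variables (F : fieldType) (g : lieAlgType F) (s : lieSubalgebra g) (V : vectType F).
Implicit Types rho : subvs_of s -> 'End(V).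

Definition kinematical_module rho : Prop :=
  [/\ lie_module rho,
      faithful rho,
      absolutely_simple rho,
      weak_isotypic_empty rho (fun x => tens2_map (rho x)) (ext2 V)
    & preserves_scalar_product rho].

Definition ad (x : g) : 'End(g) := linfun (lie_bracket x).

Definition kinematical_decomposition rho (Z P : {vspace g}) : Prop :=
  [/\ (Z + s + P)%VS = {:g}%VS /\ directv (Z + s + P)%VS,
      (forall x u, x \in s -> u \in P -> [lie x, u] \in P),
      submodule_iso (prod_rep rho rho) (fun x : subvs_of s => ad (vsval x)) P,
      \dim Z = 1%N
    & forall z x, z \in Z -> x \in s -> [lie z, x] = 0].

Definition generic_kinematical rho (Z P : {vspace g}) : Prop :=
  kinematical_module rho /\ kinematical_decomposition rho Z P.
End Kinematical.

(** Involutive Lie algebras and symplectic involutive Lie algebras *)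

Section ILA.
Variables (F : fieldType) (g : lieAlgType F).
Implicit Type sigma : 'End(g).

Definition is_iLa sigma : Prop :=
  (forall x y, sigma [lie x, y] = [lie sigma x, sigma y]) /\
  (forall x, sigma (sigma x) = x).

Definition even_part sigma : {vspace g} := passmx.leigenspace sigma 1.
Definition odd_part sigma : {vspace g} := passmx.leigenspace sigma (-1).

(* The restriction of [ad z] to [P] (when [P] is not [ad z]-stable, its compression
   to [P]). *)
Definition ad_on (P : {vspace g}) (z : g) : 'End(subvs_of P) :=
  linfun (fun X : subvs_of P => vsproj P [lie z, vsval X]).

Definition flat sigma : Prop :=
  forall X Y T, X \in odd_part sigma -> Y \in odd_part sigma -> T \in odd_part sigma ->
    [lie [lie X, Y], T] = 0.

Definition is_siLa sigma (Omega : {skew_symmetric (subvs_of (odd_part sigma))}) : Prop :=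
  [/\ is_iLa sigma,
      nondegenerate Omega
    & forall z X Y, z \in even_part sigma ->
        Omega (ad_on (odd_part sigma) z X) Y + Omega X (ad_on (odd_part sigma) z Y) = 0].

(* [J] is a symplectic endomorphism commuting with the isotropy action, and
   [J^2 = eps id]. *)
Definition compatible_structure (eps : F) sigma
    (Omega : {skew_symmetric (subvs_of (odd_part sigma))}) : Prop :=
  exists J : 'End(subvs_of (odd_part sigma)),
    [/\ forall X Y, Omega (J X) Y + Omega X (J Y) = 0,
        forall z, z \in even_part sigma ->
          (J \o ad_on (odd_part sigma) z)%VF = (ad_on (odd_part sigma) z \o J)%VF
      & (J \o J)%VF = eps *: \1%VF].

Definition pseudo_Hermitian sigma
    (Omega : {skew_symmetric (subvs_of (odd_part sigma))}) : Prop :=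
  compatible_structure (-1) Omega.

Definition para_Hermitian sigma
    (Omega : {skew_symmetric (subvs_of (odd_part sigma))}) : Prop :=
  compatible_structure 1 Omega.
End ILA.

Section Decomposable.
Variable F : fieldType.

(* [f] is an isomorphism from the direct sum of [(g1, sigma1, Omega1)] and
   [(g2, sigma2, Omega2)] onto [(g, sigma, Omega)]. *)
Definition is_sum_iso (g1 g2 g : lieAlgType F)
    (sigma1 : 'End(g1)) (Omega1 : {skew_symmetric (subvs_of (odd_part sigma1))})
    (sigma2 : 'End(g2)) (Omega2 : {skew_symmetric (subvs_of (odd_part sigma2))})
    (sigma : 'End(g)) (Omega : {skew_symmetric (subvs_of (odd_part sigma))})
    (f : 'Hom((g1 * g2)%type, g)) : Prop :=
  [/\ bijective f,
      forall x y : (g1 * g2)%type, f [lie x, y] = [lie f x, f y],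
      forall x1 x2, f (sigma1 x1, sigma2 x2) = sigma (f (x1, x2))
    & forall X1 Y1 X2 Y2 X Y,
        vsval X = f (vsval X1, vsval X2) -> vsval Y = f (vsval Y1, vsval Y2) ->
        Omega X Y = Omega1 X1 Y1 + Omega2 X2 Y2].

Definition decomposable (g : lieAlgType F) (sigma : 'End(g))
    (Omega : {skew_symmetric (subvs_of (odd_part sigma))}) : Prop :=
  exists (g1 g2 : lieAlgType F) (sigma1 : 'End(g1)) (sigma2 : 'End(g2))
    (Omega1 : {skew_symmetric (subvs_of (odd_part sigma1))})
    (Omega2 : {skew_symmetric (subvs_of (odd_part sigma2))})
    (f : 'Hom((g1 * g2)%type, g)),
    [/\ is_siLa Omega1 /\ is_siLa Omega2,
        ({:g1} != 0)%VS /\ ({:g2} != 0)%VS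
      & is_sum_iso Omega1 Omega2 Omega f].

Definition indecomposable (g : lieAlgType F) (sigma : 'End(g))
    (Omega : {skew_symmetric (subvs_of (odd_part sigma))}) : Prop :=
  ~ decomposable Omega.
End Decomposable.

(* [(g, sigma, Omega)] is the siLa associated with [g = Z + s + P]; the
   identification of [(Z + s) / s] with the base field sends the class of the
   generator [z0] of [Z] to [1]. *)
Definition associated_siLa (F : fieldType) (g : lieAlgType F) (s : lieSubalgebra g)
    (Z P : {vspace g}) (z0 : g) (sigma : 'End(g))
    (Omega : {skew_symmetric (subvs_of (odd_part sigma))}) : Prop :=
  [/\ Z = <[z0]>%VS,
      (forall h, h \in (Z + s)%VS -> sigma h = h),
      (forall X, X \in P -> sigma X = - X),
      (forall X Y, [lie vsval X, vsval Y] - Omega X Y *: z0 \in lsub_space s)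
    & is_siLa Omega].

(** Semisimplicity of the action of the line [Z] over the reals *)

Definition end_mx (F : fieldType) (U : vectType F) (f : 'End(U)) : 'M[F]_(\dim {:U}) :=
  passmx.mxof (vbasis {:U}) (vbasis {:U}) f.

Definition real_semisimple_action (R : realType) (g : lieAlgType R)
    (Z P : {vspace g}) : Prop :=
  exists z0 : g, Z = <[z0]>%VS /\ diagonalizable (end_mx (ad_on P z0)).

Definition semisimple_action (R : realType) (g : lieAlgType R)
    (Z P : {vspace g}) : Prop :=
  exists z0 : g,
    Z = <[z0]>%VS /\ diagonalizable (map_mx (real_complex R) (end_mx (ad_on P z0))).

(* Main.v *)
(** By Schur's lemma an [s]-equivariant endomorphism of [P = V (+) V] is a 2x2
matrix tensored with [id_V], and [Omega] is the invariant scalar product of [V]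
tensored with an area form of the plane. Hence the action [D] of [Z] on [P],
being symplectic, is a traceless 2x2 matrix, and [D^2 = e id] by
Cayley-Hamilton. Diagonalizability of [D] over the reals forces [e >= 0] and holds if
[e > 0]; complex diagonalizability makes [D] vanish if [e = 0]. If [e <> 0],
rescaling [D] gives the structure; if [D = 0], the reflection
[(u, v) |-> (u, -v)] is para-complex. *)
Require Import Defs.
From HB Require Import structures.
From mathcomp Require Import all_boot all_order all_algebra.
From mathcomp Require Import reals.
From mathcomp Require Import boolp complex ring.

Local Open Scope ring_scope.

Import Order.TTheory GRing.Theory Num.Theory.

(** * Matrices with scalar square *)

Lemma diagonalizable_sqr (F : fieldType) n (A : 'M[F]_n) (e : F) :
  diagonalizable A -> A *m A = e%:M ->
  (e = 0 -> A = 0) /\ ((0 < n)%N -> exists d, d * d = e).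
Proof.
move=> [P Pu /diagonalizable_forPex [d /(simmxP Pu) PA]] AA.
(* The rows of [P] are eigenvectors of [A]; squaring the diagonal form and cancelling [P] shows that
   every eigenvalue squares to [e]. *)
have dd i : d 0 i * d 0 i = e.
  have : diag_mx d *m diag_mx d *m P = e%:M *m P.
    by rewrite -mulmxA -PA mulmxA -PA -mulmxA AA scalar_mxC.
  move/(can_inj (mulmxK Pu))/matrixP/(_ i i).
  by rewrite mulmx_diag !mxE eqxx !mulr1n.
split=> [e0|n_gt0]; last by exists (d 0 (Ordinal n_gt0)).
have d0 : d = 0.
  apply/rowP => i; rewrite mxE; apply/eqP.
  by move/eqP: (dd i); rewrite e0 mulf_eq0 orbb.
apply: (can_inj (mulKmx Pu)); rewrite PA d0 mulmx0.
by rewrite [diag_mx 0]linear0 mul0mx.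
Qed.

(** The minimal polynomial divides [(X - r)(X + r)], whose roots are distinct. Size 0 is split off
    because the criterion by minimal polynomials concerns non-empty matrices. *)
Lemma sqr_diagonalizable (F : fieldType) n (A : 'M[F]_n) (r : F) :
  r != - r -> A *m A = (r * r)%:M -> diagonalizable A.
Proof.
move=> rN; case: n A => [|n] A AA; first by rewrite [A]thinmx0; apply: diagonalizable0.
apply/diagonalizableP; exists [:: r; - r]; first by rewrite /= inE rN.
apply: mxminpoly_min; rewrite !big_cons big_nil mulr1 rmorphM /= !rmorphB /=.
rewrite !horner_mx_X !horner_mx_C -!mulmxE raddfN opprK.
rewrite mulmxBl !mulmxDr AA -scalar_mxM -scalar_mxC.
by rewrite opprD [- _ - _]addrC addrACA !subrr addr0.
Qed.

Lemma end_mx_sqr (F : fieldType) (U : vectType F) (f : 'End(U)) (e : F) :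
  (f \o f)%VF = e *: \1%VF -> end_mx f *m end_mx f = e%:M.
Proof.
(* The added zero map gives the right-hand side the shape [a *: f + g] that [passmx.mxof_linear]
   expects. *)
move=> ff; rewrite /end_mx -passmx.mxof_comp ?vbasisP // ff -[_ *: _]addr0.
rewrite passmx.mxof_linear passmx.mxof1 ?(basis_free (vbasisP _)) // scalemx1.
by rewrite [X in _ + X](_ : _ = 0) ?addr0 //; apply/eqP; rewrite passmx.mxof_eq0 ?vbasisP.
Qed.

Lemma end_mx_eq0 (F : fieldType) (U : vectType F) (f : 'End(U)) :
  end_mx f = 0 -> f = 0.
Proof. by move/eqP; rewrite /end_mx passmx.mxof_eq0 ?vbasisP // => /eqP. Qed.

(** * Linear maps and non-degenerate forms *)

Lemma lin_lfunE (F : fieldType) (U W : vectType F) (f : U -> W) :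
  linear f -> linfun f =1 f.
Proof.
move=> lin x; pose h := GRing.isLinear.Build _ _ _ _ _ lin.
pose k : {linear U -> W} := HB.pack f h.
exact: (lfunE k x).
Qed.

(** The sign [eps] is left free so that this serves both the symmetric form on [V] and the skew form
    on [P]. *)
Lemma nondegenerate_inj (F : fieldType) (V : vectType F) (eps : bool)
    (b : {hermitian V for eps & idfun}) p q :
  nondegenerate b -> (forall v, b p v = b q v) -> p = q.
Proof.
move=> /eqP nd pq; apply/eqP; rewrite -subr_eq0 -memv0 -nd.
apply/mem_orthovP => v _; rewrite linearBl; apply/eqP; rewrite subr_eq0.
exact/eqP/pq.
Qed.

(** * Schur's lemma for endomorphisms and for invariant forms *)

Section Schur.
Variables (F : fieldType) (L : lieAlgType F) (V : vectType F) (rho : L -> 'End(V)).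
Variable b : {symmetric V}.
Hypotheses (rho_abs : absolutely_simple rho) (b_nd : nondegenerate b).
Hypothesis b_inv : forall x u v, b (rho x u) v + b u (rho x v) = 0.

Lemma schur_scalar (h : V -> V) :
  linear h -> (forall x v, h (rho x v) = rho x (h v)) ->
  exists a : F, forall v, h v = a *: v.
Proof.
move=> lin hC; have [_ /(_ (linfun h)) []] := rho_abs.
  by move=> x; apply/lfunP => v; rewrite !comp_lfunE !lin_lfunE.
move=> a ha; exists a => v.
by rewrite -(lin_lfunE _ _ _ _ lin) ha scale_lfunE id_lfunE.
Qed.

Let flat_form (u : V) : 'Hom(V, F^o) := linfun (b u : V -> F^o).

Let flat_formE u v : flat_form u v = b u v.
Proof. by rewrite lin_lfunE // => a p q; rewrite linearDr linearZr. Qed.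

(** The map from [V] to its dual given by [b] is injective by non-degeneracy, hence onto by equality
    of dimensions. *)
Lemma nondegenerate_sharp (phi : 'Hom(V, F^o)) : exists u, forall v, phi v = b u v.
Proof.
have lin : linear flat_form.
  move=> a p q; apply/lfunP => v.
  by rewrite add_lfunE scale_lfunE !flat_formE linearPl.
have ker0 : lker (linfun flat_form) == 0%VS.
  apply/lker0P => p q; rewrite !lin_lfunE // => pq.
  by apply: (nondegenerate_inj _ _ _ _ _ _ b_nd) => v; rewrite -!flat_formE pq.
have img : limg (linfun flat_form) = fullv.
  apply/eqP; rewrite eqEdim subvf limg_dim_eq; last first.
    by move/eqP: ker0 => ->; rewrite capv0.
  by rewrite !dimvf /dim /= muln1.
exists ((linfun flat_form)^-1%VF phi) => v.
rewrite -flat_formE -[flat_form _](lin_lfunE _ _ _ _ lin) limg_lfunVK //.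
by rewrite img memvf.
Qed.

(** Writing [B u v = b (T u) v], the invariance of both forms makes [T] equivariant, hence
    scalar. *)
Lemma schur_form (B : V -> V -> F) :
  (forall v, linear (B^~ v : V -> F^o)) -> (forall u, linear (B u : V -> F^o)) ->
  (forall x u v, B (rho x u) v + B u (rho x v) = 0) ->
  exists c : F, forall u v, B u v = c * b u v.
Proof.
move=> linl linr Binv.
(* The representing vector is chosen by [cid]; its uniqueness then yields linearity and equivariance
   of [T]. *)
have ex u : {t | forall v, B u v = b t v}.
  apply: cid; have [t tP] := nondegenerate_sharp (linfun (B u : V -> F^o)).
  by exists t => v; rewrite -tP lin_lfunE.
pose T u := sval (ex u); have TE u v : B u v = b (T u) v by rewrite /T; case: (ex u).
have inj p q := nondegenerate_inj _ _ _ b p q b_nd.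
have [||c cP] := schur_scalar T.
- by move=> a p q; apply: inj => v; rewrite linearPl /= -(TE p) -(TE q) -TE; apply: linl.
- move=> x u; apply: inj => v; rewrite -TE.
  move: (Binv x u v) (b_inv x (T u) v) => /eqP; rewrite addr_eq0 => /eqP -> /eqP.
  by rewrite addr_eq0 TE => /eqP ->.
by exists c => u v; rewrite TE cP linearZl.
Qed.

(** * Invariant symplectic forms and equivariant maps on a double of [V] *)

Section Double.
Variables (W : vectType F) (A : L -> 'End(W)) (Om : {skew_symmetric W}).
Variables (f : 'Hom((V * V)%type, W)) (g : 'Hom(W, (V * V)%type)).
Hypotheses (fK : cancel f g) (gK : cancel g f) (two_neq0 : 2%:R != 0 :> F).
Hypothesis fA : forall x u v, f (rho x u, rho x v) = A x (f (u, v)).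
Hypothesis Om_nd : nondegenerate Om.
Hypothesis Om_inv : forall x X Y, Om (A x X) Y + Om X (A x Y) = 0.

Let bC u v : b u v = b v u.
Proof. by rewrite [LHS](@hermitian_subproof _ _ _ _ b u v) expr0 mul1r. Qed.

Let OmC X Y : Om X Y = - Om Y X.
Proof. by rewrite [LHS](@hermitian_subproof _ _ _ _ Om X Y) expr1 mulN1r. Qed.

Let V_neq0 : exists u v, b u v != 0.
Proof.
have [[V0 _] _] := rho_abs.
have /eqP u_neq0 : vpick {:V} != 0 by rewrite vpick0.
apply: contrapT => nex; apply: u_neq0.
apply: (nondegenerate_inj _ _ _ _ _ _ b_nd) => v; rewrite linear0l.
by apply/eqP; apply: contrapT => /negP buv; apply: nex; exists (vpick {:V}), v.
Qed.

Let i1 (u : V) : V * V := (u, 0).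
Let i2 (u : V) : V * V := (0, u).

Let i1_lin a u v : i1 (a *: u + v) = a *: i1 u + i1 v.
Proof. by congr pair; rewrite /= ?scaler0 ?addr0. Qed.

Let i2_lin a u v : i2 (a *: u + v) = a *: i2 u + i2 v.
Proof. by congr pair; rewrite /= ?scaler0 ?addr0. Qed.

Let split_pair (p : V * V) : p = i1 p.1 + i2 p.2.
Proof. by case: p => u v; congr pair; rewrite /= ?addr0 ?add0r. Qed.

Let fE p : f p = f (i1 p.1) + f (i2 p.2).
Proof. by rewrite {1}(split_pair p) linearD. Qed.

Let OmDl X X' Y : Om (X + X') Y = Om X Y + Om X' Y.
Proof. by rewrite linearDl. Qed.

Let OmDr X Y Y' : Om X (Y + Y') = Om X Y + Om X Y'.
Proof. by rewrite linearDr. Qed.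

Let bZl a u v : b (a *: u) v = a * b u v.
Proof. by rewrite linearZl_LR. Qed.

Let bZr a u v : b u (a *: v) = a * b u v.
Proof. by rewrite linearZr_LR. Qed.

Let b0l v : b 0 v = 0.
Proof. by rewrite linear0l. Qed.

Let b0r v : b v 0 = 0.
Proof. by rewrite linear0r. Qed.

Let bNl u v : b (- u) v = - b u v.
Proof. by rewrite linearNl. Qed.

Let bNr u v : b u (- v) = - b u v.
Proof. by rewrite linearNr. Qed.

Let fi1 x u : f (i1 (rho x u)) = A x (f (i1 u)).
Proof. by rewrite -fA linear0. Qed.

Let fi2 x u : f (i2 (rho x u)) = A x (f (i2 u)).
Proof. by rewrite -fA linear0. Qed.

Let gA x X : g (A x X) = (rho x (g X).1, rho x (g X).2).
Proof. by apply: (can_inj fK); rewrite gK fA -surjective_pairing gK. Qed.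

(** Pulling [Om] back along two equivariant embeddings of [V] gives one block of its matrix: an
    invariant form, to which [schur_form] applies. *)
Let pull_form (i j : V -> V * V) :
  (forall a u v, i (a *: u + v) = a *: i u + i v) ->
  (forall a u v, j (a *: u + v) = a *: j u + j v) ->
  (forall x u, f (i (rho x u)) = A x (f (i u))) ->
  (forall x u, f (j (rho x u)) = A x (f (j u))) ->
  exists c : F, forall u v, Om (f (i u)) (f (j v)) = c * b u v.
Proof.
move=> il jl iA jA; apply: schur_form.
- by move=> v a p q; rewrite il linearP linearPl.
- by move=> u a p q; rewrite jl linearP linearPr.
- by move=> x u v; rewrite iA jA Om_inv.
Qed.

(* [Omega] is skew and [b] symmetric, so [c = 0]. *)
Let isotropic (i : V -> V * V) c :
  (forall u v, Om (f (i u)) (f (i v)) = c * b u v) ->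
  forall u v, Om (f (i u)) (f (i v)) = 0.
Proof.
move=> ic u v; apply/eqP; have := OmC (f (i u)) (f (i v)).
rewrite [X in - X]ic bC -ic => /eqP.
by rewrite -subr_eq0 opprK -mulr2n -mulr_natl mulf_eq0 (negPf two_neq0).
Qed.

(** The diagonal blocks vanish and skewness ties the two others together, leaving a single constant
    [k]. *)
Lemma double_form :
  exists2 k : F, k != 0 &
    forall p q, Om (f p) (f q) = k * (b p.1 q.2 - b p.2 q.1).
Proof.
have [c1 /isotropic Om11] := pull_form i1 i1 i1_lin i1_lin fi1 fi1.
have [c2 /isotropic Om22] := pull_form i2 i2 i2_lin i2_lin fi2 fi2.
have [k Om12] := pull_form i1 i2 i1_lin i2_lin fi1 fi2.
have OmE p q : Om (f p) (f q) = k * (b p.1 q.2 - b p.2 q.1).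
  rewrite (fE p) (fE q) OmDl !OmDr.
  rewrite Om11 Om22 Om12 [X in _ + (X + _)]OmC Om12 !addr0 !add0r.
  by rewrite (bC q.1) mulrBr.
(* With [k = 0] the form [Om] would vanish, so [f (u, 0) = 0] and [u = 0], against [b u v != 0]. *)
exists k => //; apply/eqP => k0; have [u [v /eqP []]] := V_neq0.
have fi0 : f (i1 u) = 0.
  apply: (nondegenerate_inj _ _ _ _ _ _ Om_nd) => Y.
  by rewrite linear0l -[Y]gK OmE k0 mul0r.
have : i1 u = 0 by apply: (can_inj fK); rewrite fi0 linear0.
by case=> ->; rewrite linear0l.
Qed.

(** This yields one column of the 2x2 matrix of [D]: both coordinates of [D] on an embedded copy of
    [V] are equivariant, hence scalars. *)
Let component (D : 'End(W)) (i : V -> V * V) :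
  (forall x X, D (A x X) = A x (D X)) ->
  (forall a u v, i (a *: u + v) = a *: i u + i v) ->
  (forall x u, f (i (rho x u)) = A x (f (i u))) ->
  exists a c : F, forall u, D (f (i u)) = f (a *: u, c *: u).
Proof.
move=> DA il iA.
have [||a aP] := schur_scalar (fun u => (g (D (f (i u)))).1).
- by move=> a u v; rewrite il !linearP.
- by move=> x u; rewrite iA DA gA.
have [||c cP] := schur_scalar (fun u => (g (D (f (i u)))).2).
- by move=> c u v; rewrite il !linearP.
- by move=> x u; rewrite iA DA gA.
by exists a, c => u; rewrite -aP -cP -surjective_pairing gK.
Qed.

Lemma double_sqr (D : 'End(W)) :
  (forall x X, D (A x X) = A x (D X)) ->
  (forall X Y, Om (D X) Y + Om X (D Y) = 0) ->
  exists e : F, (D \o D)%VF = e *: \1%VF.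
Proof.
move=> DA Dsp; have [k k0 OmE] := double_form.
have [a [c D1]] := component D i1 DA i1_lin fi1.
have [d [h D2]] := component D i2 DA i2_lin fi2.
(* Pairing [f (u, 0)] with [f (0, v)] turns the symplectic condition into [k * (a + h) * b u v = 0]:
   the trace vanishes. *)
have ha : h = - a.
  have [u [v buv]] := V_neq0.
  have := Dsp (f (i1 u)) (f (i2 v)); rewrite D1 D2 !OmE /=.
  rewrite bZl bZr b0l b0r !subr0 -mulrDr => /eqP.
  rewrite mulf_eq0 (negPf k0) /= -mulrDl mulf_eq0.
  by rewrite (negPf buv) orbF addrC addr_eq0 => /eqP.
have DE u v : D (f (u, v)) = f (a *: u + d *: v, c *: u - a *: v).
  rewrite (fE (u, v)) linearD /= D1 D2 ha -linearD.
  by congr (f (_, _)); rewrite scaleNr.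
(* This is minus the determinant of the traceless matrix, as Cayley-Hamilton predicts. *)
exists (a * a + d * c); apply/lfunP => X.
rewrite comp_lfunE scale_lfunE id_lfunE -[X]gK; case: (g X) => u v.
rewrite !DE -linearZ; congr (f (_, _)) => /=.
- rewrite !scalerDr !scalerA scalerN scalerDl scalerA addrACA [d * a]mulrC.
  by rewrite subrr addr0.
- rewrite !scalerDr !scalerN !scalerA opprD opprK addrACA [c * a]mulrC.
  by rewrite subrr add0r [c * d]mulrC -scalerDl [a * a + _]addrC.
Qed.

(** The reflection acts on the plane of multiplicities only, so it is equivariant; having trace
    zero, it is infinitesimally symplectic. *)
Lemma double_para :
  exists J : 'End(W), [/\ forall X Y, Om (J X) Y + Om X (J Y) = 0,
    forall x X, J (A x X) = A x (J X) & (J \o J)%VF = \1%VF].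
Proof.
have [k _ OmE] := double_form.
pose h X := f ((g X).1, - (g X).2).
have hlin : linear h.
  move=> a X Y; rewrite /h (linearP g) -(linearP f) /=.
  by apply: congr1; congr pair; rewrite /= opprD scalerN.
have hE X : linfun h X = h X by rewrite lin_lfunE.
exists (linfun h); split.
- move=> X Y; rewrite !hE -{1}[Y]gK -{2}[X]gK /h !OmE /=.
  rewrite bNl bNr; ring.
- by move=> x X; rewrite !hE /h gA /= -linearN fA.
- apply/lfunP => X; rewrite comp_lfunE id_lfunE !hE /h fK /= opprK.
  by rewrite -surjective_pairing gK.
Qed.
End Double.
End Schur.

(** * Bracket identities and the eigenspaces of the involution *)

Section LieFacts.
Variables (F : fieldType) (g : lieAlgType F).
Implicit Types (x y z : g) (U : {vspace g}).

Lemma adE x y : ad x y = [lie x, y].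
Proof. by rewrite lin_lfunE //; exact: lie_linear_r. Qed.

Lemma lieNr x y : [lie x, - y] = - [lie x, y].
Proof. by rewrite -!adE linearN. Qed.

Lemma lieDl x y z : [lie x + y, z] = [lie x, z] + [lie y, z].
Proof. by have := lie_linear_l z 1 x y; rewrite /= !scale1r. Qed.

Lemma lieC x y : [lie x, y] = - [lie y, x].
Proof.
apply/eqP; rewrite -addr_eq0; apply/eqP.
have := lie_alt (x + y); rewrite lieDl -!adE !linearD /= !adE !lie_alt.
by rewrite add0r addr0.
Qed.

(** One term of the Jacobi identity drops out. This makes the action of [Z] commute with that of
    [s]. *)
Lemma lie_commute x y z : [lie x, y] = 0 ->
  [lie x, [lie y, z]] = [lie y, [lie x, z]].
Proof.
move=> xy; have := lie_jacobi x y z.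
rewrite xy -(adE z 0) linear0 addr0 [[lie z, x]]lieC lieNr => /eqP.
by rewrite subr_eq0 => /eqP.
Qed.

Lemma ad_onE U z (X : subvs_of U) : ad_on U z X = vsproj U [lie z, vsval X].
Proof.
by rewrite lin_lfunE // => a u v; rewrite !linearP /= lie_linear_r linearP.
Qed.

Lemma vsval_ad_on U z (X : subvs_of U) :
  [lie z, vsval X] \in U -> vsval (ad_on U z X) = [lie z, vsval X].
Proof. by move=> zX; rewrite ad_onE vsprojK. Qed.

Lemma ad_on_lin U a x y :
  ad_on U (a *: x + y) = a *: ad_on U x + ad_on U y.
Proof.
apply/lfunP => X; rewrite add_lfunE scale_lfunE !ad_onE.
by rewrite (lie_linear_l (vsval X) a) linearP.
Qed.

Lemma even_partP (sigma : 'End(g)) x :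
  reflect (sigma x = x) (x \in even_part sigma).
Proof.
rewrite memv_ker !lfun_simp /= scale1r subr_eq0.
exact: eqP.
Qed.

Lemma odd_partP (sigma : 'End(g)) x :
  reflect (sigma x = - x) (x \in odd_part sigma).
Proof.
rewrite memv_ker !lfun_simp /= scaleN1r subr_eq0.
exact: eqP.
Qed.

Lemma lie_even_odd (sigma : 'End(g)) z x : is_iLa sigma ->
  z \in even_part sigma -> x \in odd_part sigma -> [lie z, x] \in odd_part sigma.
Proof.
move=> [sigmaM _] /even_partP sz /odd_partP sx; apply/odd_partP.
by rewrite sigmaM sz sx lieNr.
Qed.

(** On [x = h + u] the involution gives [h - u]; an eigenvector thus has one component equal to its
    opposite, hence zero since 2 is invertible. *)
Lemma eigenspaces_of_decomposition (sigma : 'End(g)) (H U : {vspace g}) :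
  2%:R != 0 :> F -> (H + U)%VS = fullv ->
  (forall h, h \in H -> sigma h = h) -> (forall u, u \in U -> sigma u = - u) ->
  even_part sigma = H /\ odd_part sigma = U.
Proof.
move=> two HU sH sU.
have eqN (x : g) : x = - x -> x = 0.
  move=> /eqP; rewrite -subr_eq0 opprK -mulr2n -scaler_nat scaler_eq0 (negPf two).
  by move/eqP.
have dec x : exists2 h, h \in H & exists2 u, u \in U & x = h + u.
  by apply/memv_addP; rewrite HU memvf.
split; apply/vspaceP => x.
- apply/even_partP/idP => [|/sH //]; have [h hH [u uU ->]] := dec x.
  by rewrite linearD /= sH // sU // => /addrI /esym /eqN ->; rewrite addr0.
- apply/odd_partP/idP => [|/sU //]; have [h hH [u uU ->]] := dec x.
  by rewrite linearD /= sH // sU // opprD => /addIr /eqN ->; rewrite add0r.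
Qed.
End LieFacts.

(** * From the action of [Z] to a compatible structure *)

Lemma prod_repE (F : fieldType) (L : lieAlgType F) (V W : vectType F)
    (rhoV : L -> 'End(V)) (rhoW : L -> 'End(W)) x p :
  prod_rep rhoV rhoW x p = (rhoV x p.1, rhoW x p.2).
Proof. by rewrite lin_lfunE // => a u v; congr pair; rewrite /= linearP. Qed.


(** This gathers what both signs share. It allows any generator [z] of [Z], since the semisimplicity
    hypotheses bring their own. *)
Lemma kinematical_compatible (F : fieldType) (g : lieAlgType F) (s : lieSubalgebra g)
    (V : vectType F) (rho : subvs_of s -> 'End(V)) (Z : {vspace g}) (z : g)
    (sigma : 'End(g)) (Omega : {skew_symmetric (subvs_of (odd_part sigma))}) :
  2%:R != 0 :> F -> generic_kinematical rho Z (odd_part sigma) ->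
  is_siLa Omega -> even_part sigma = (Z + s)%VS -> Z = <[z]>%VS ->
  let D := ad_on (odd_part sigma) z in
  [/\ (0 < \dim {:subvs_of (odd_part sigma)})%N,
      D = 0 -> compatible_structure 1 Omega
    & exists2 e : F, (D \o D)%VF = e *: \1%VF &
        forall eps r, r != 0 -> e = eps * (r * r) -> compatible_structure eps Omega].
Proof.
move=> two [[_ _ rho_abs _ [b [b_nd b_inv]]] [_ sP [f0 [f0_ker f0_img f0_eqv]] _ Zs]].
move=> [iLa Om_nd Om_inv] evenE Zz D; set P := odd_part sigma in sP f0_img D *.
have evZ : z \in even_part sigma.
  by rewrite evenE (subvP (addvSl _ _)) // Zz memv_line.
have evs (x : subvs_of s) : vsval x \in even_part sigma.
  by rewrite evenE (subvP (addvSr _ _)) // subvsP.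
have adE_even y X : y \in even_part sigma -> vsval (ad_on P y X) = [lie y, vsval X].
  by move=> ye; rewrite vsval_ad_on // lie_even_odd // subvsP.
pose A (x : subvs_of s) := ad_on P (vsval x).
have DA x X : D (A x X) = A x (D X).
  apply: subvs_inj; rewrite !adE_even //; apply: lie_commute.
  by rewrite Zs ?subvsP // Zz memv_line.
have f0P p : f0 p \in P by rewrite -f0_img memv_img ?memvf.
have flin : linear (fun p => vsproj P (f0 p)) by move=> a p q; rewrite !linearP.
have glin : linear (fun X : subvs_of P => f0^-1%VF (vsval X)).
  by move=> a X Y; rewrite !linearP.
(* The given embedding of the double of [V] into the Lie algebra is corestricted to its image [P],
   where it becomes invertible. *)
pose f := linfun (fun p => vsproj P (f0 p)).
pose h := linfun (fun X : subvs_of P => f0^-1%VF (vsval X)).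
have fK : cancel f h.
  by move=> p; rewrite !lin_lfunE // vsprojK // lker0_lfunK ?f0_ker.
have hK : cancel h f.
  by move=> X; rewrite !lin_lfunE // limg_lfunVK ?vsvalK // f0_img subvsP.
have fA x u v : f (rho x u, rho x v) = A x (f (u, v)).
  apply: subvs_inj; rewrite adE_even // !lin_lfunE // !vsprojK //.
  by rewrite -adE -f0_eqv prod_repE.
have A_inv x X Y : Omega (A x X) Y + Omega X (A x Y) = 0 by apply: Om_inv.
(* An even element is [c *: z + x] with [x] in [s], so commuting with [D] and with each [A x] is
   enough. *)
have compatible eps (J : 'End(subvs_of P)) :
    (forall X Y, Omega (J X) Y + Omega X (J Y) = 0) ->
    (forall x X, J (A x X) = A x (J X)) -> (forall X, J (D X) = D (J X)) ->
    (J \o J)%VF = eps *: \1%VF -> compatible_structure eps Omega.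
  move=> Jsp JA JD JJ; exists J; split => // y; rewrite evenE Zz.
  move=> /memv_addP [_ /vlineP [c ->] [x xs ->]]; apply/lfunP => X.
  have xE : ad_on P x = A (vsproj s x) by rewrite /A vsprojK.
  rewrite !comp_lfunE ad_on_lin !add_lfunE !scale_lfunE linearD linearZ /= -/D xE.
  by rewrite JD JA.
split.
- have [[V0 _] _] := rho_abs; rewrite lt0n; apply: contra_neq V0 => dim0.
  apply/eqP; rewrite -subv0; apply/subvP => u _; rewrite memv0.
  (* If [P] were zero, injectivity of [f] would force [V] to be zero. *)
  have : f (u, 0) \in {:subvs_of P}%VS by rewrite memvf.
  move/eqP: dim0; rewrite dimv_eq0 => /eqP ->; rewrite memv0 => /eqP fu.
  have : (u, 0) = 0 :> V * V by apply: (can_inj fK); rewrite fu linear0.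
  by case=> ->.
- move=> D0.
  have [J [Jsp JA JJ]] := double_para _ _ _ _ _ rho_abs b_nd b_inv _ _ _ _ _ fK hK two fA Om_nd A_inv.
  apply: (compatible _ J) => // [X|]; first by rewrite D0 !zero_lfunE linear0.
  by rewrite scale1r.
have Dsp X Y : Omega (D X) Y + Omega X (D Y) = 0 by apply: Om_inv.
have [e DD] := double_sqr _ _ _ _ _ rho_abs b_nd b_inv _ _ _ _ _ fK hK two fA Om_nd A_inv D DA Dsp.
(* The rescaled map has square [e / r^2 = eps]. *)
exists e => // eps r r0 eE; apply: (compatible _ (r^-1 *: D)).
- by move=> X Y; rewrite !scale_lfunE linearZl_LR linearZr_LR /= -mulrDr Dsp mulr0.
- by move=> x X; rewrite !scale_lfunE DA linearZ.
- by move=> X; rewrite !scale_lfunE linearZ.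
- rewrite -comp_lfunZl -comp_lfunZr DD !scalerA eE; congr (_ *: _).
  by field.
Qed.

(** * Real and complex semisimplicity read off from the sign of [e] *)

Theorem proposition3p4 (R : realType) (g : lieAlgType R) (s : lieSubalgebra g)
    (V : vectType R) (rho : subvs_of s -> 'End(V)) (Z P : {vspace g}) (z0 : g)
    (sigma : 'End(g)) (Omega : {skew_symmetric (subvs_of (odd_part sigma))})
    (hkin : generic_kinematical rho Z P)
    (hassoc : associated_siLa s Z P z0 Omega)
    (hindec : indecomposable Omega)
    (hnonflat : ~ flat sigma)
    (hss : semisimple_action Z P) :
  (~ real_semisimple_action Z P -> pseudo_Hermitian Omega) /\
  (real_semisimple_action Z P -> para_Hermitian Omega).
Proof.
have two : 2%:R != 0 :> R by rewrite pnatr_eq0.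
have [_ sigmaH sigmaP _ siLa] := hassoc.
have [evenE oddE] : even_part sigma = (Z + s)%VS /\ odd_part sigma = P.
  by have [_ [[full _] _ _ _ _]] := hkin; apply: eigenspaces_of_decomposition.
(* [P] is replaced by the odd part, which keeps the type of [Omega] intact. *)
subst P; split.
- move=> not_real; have [z [Zz Dss]] := hss.
  have [_ _ [e DD ex]] := kinematical_compatible _ _ _ _ _ _ _ _ _ two hkin siLa evenE Zz.
  have MM := end_mx_sqr _ _ _ _ DD.
  have [e_gt0|e_lt0|e0] := ltrgt0P e.
  (* For [e > 0] the distinct real values [sqrt e] and [- sqrt e] diagonalize the action, a
     contradiction. *)
  + case: not_real; exists z; split => //.
    apply: (@sqr_diagonalizable _ _ _ (Num.sqrt e)).
      by rewrite -subr_eq0 opprK -mulr2n mulrn_eq0 /= gt_eqF // sqrtr_gt0.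
    by rewrite -expr2 sqr_sqrtr // ltW.
  + apply: (ex _ (Num.sqrt (- e))).
      by rewrite gt_eqF // sqrtr_gt0 oppr_gt0.
    by rewrite -expr2 sqr_sqrtr ?mulN1r ?opprK // oppr_ge0 ltW.
  + case: not_real; exists z; split => //.
    (* A complex diagonalizable matrix with zero square is zero, and the embedding of the reals is
       injective on matrices. *)
    rewrite (_ : end_mx _ = 0); first exact: diagonalizable0.
    apply: (map_mx_inj (f := real_complex R)); rewrite map_mx0.
    have CC : map_mx (real_complex R) (end_mx (ad_on (odd_part sigma) z)) *m
        map_mx (real_complex R) (end_mx (ad_on (odd_part sigma) z)) = 0%:M.
      by rewrite -map_mxM MM e0 map_scalar_mx rmorph0.
    by have [C0 _] := diagonalizable_sqr _ _ _ _ Dss CC; apply: C0.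
- move=> [z [Zz Dss]].
  have [dim_gt0 ex0 [e DD ex]] := kinematical_compatible _ _ _ _ _ _ _ _ _ two hkin siLa evenE Zz.
  have [M0 Msq] := diagonalizable_sqr _ _ _ _ Dss (end_mx_sqr _ _ _ _ DD).
  (* Since [P] is non-zero there is a real eigenvalue [d]; when [e] is non-zero it serves as the
     scaling factor. *)
  have [d dd] := Msq dim_gt0.
  have [e0|e0] := eqVneq e 0; first by apply/ex0/end_mx_eq0/M0.
  apply: (ex _ d); last by rewrite mul1r.
  by apply: contra_neq e0 => d0; rewrite -dd d0 mul0r.
Qed.
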